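(* For a metrizable topological space $X$, the following are equivalent: (a) $X$ is LCS-complete; (b) $X$ is domain-complete; (c) $X$ is completely metrizable.
   Context: A space is domain-complete (resp. LCS-complete) if it is homeomorphic to a $G_\delta$ subset (countable intersection of open sets), with the subspace topology, of some continuous dcpo with its Scott topology (resp. of some locally compact sober space, locally compact meaning every point has a neighborhood base of compact saturated sets). *)

(* Defs.v *)
From Stdlib Require Import Reals List.
Open Scope R_scope.

Definition is_topology {X : Type} (opn : (X -> Prop) -> Prop) : Prop :=
  opn (fun _ => True) /\
  (forall U V, opn U -> opn V -> opn (fun x => U x /\ V x)) /\
  (forall F : (X -> Prop) -> Prop, (forall U, F U -> opn U) ->
     opn (fun x => exists U, F U /\ U x)).

Definition subspace {X : Type} (opn : (X -> Prop) -> Prop) (A : X -> Prop)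
  : ({x | A x} -> Prop) -> Prop :=
  fun V => exists U, opn U /\ forall z : {x | A x}, V z <-> U (proj1_sig z).

Definition continuous {X Y : Type} (oX : (X -> Prop) -> Prop)
  (oY : (Y -> Prop) -> Prop) (f : X -> Y) : Prop :=
  forall V, oY V -> oX (fun x => V (f x)).

Definition homeomorphic {X Y : Type} (oX : (X -> Prop) -> Prop)
  (oY : (Y -> Prop) -> Prop) : Prop :=
  exists (f : X -> Y) (g : Y -> X),
    (forall x, g (f x) = x) /\ (forall y, f (g y) = y) /\
    continuous oX oY f /\ continuous oY oX g.

Definition G_delta {X : Type} (opn : (X -> Prop) -> Prop) (A : X -> Prop) : Prop :=
  exists U : nat -> X -> Prop, (forall n, opn (U n)) /\
    forall x, A x <-> forall n, U n x.

Definition is_poset {D : Type} (le : D -> D -> Prop) : Prop :=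
  (forall x, le x x) /\ (forall x y, le x y -> le y x -> x = y) /\
  (forall x y z, le x y -> le y z -> le x z).

Definition directed {D : Type} (le : D -> D -> Prop) (S : D -> Prop) : Prop :=
  (exists x, S x) /\
  forall x y, S x -> S y -> exists z, S z /\ le x z /\ le y z.

Definition is_lub {D : Type} (le : D -> D -> Prop) (S : D -> Prop) (s : D) : Prop :=
  (forall x, S x -> le x s) /\ (forall u, (forall x, S x -> le x u) -> le s u).

Definition is_dcpo {D : Type} (le : D -> D -> Prop) : Prop :=
  is_poset le /\ forall S, directed le S -> exists s, is_lub le S s.

Definition way_below {D : Type} (le : D -> D -> Prop) (x y : D) : Prop :=
  forall S s, directed le S -> is_lub le S s -> le y s -> exists z, S z /\ le x z.

Definition is_continuous_dcpo {D : Type} (le : D -> D -> Prop) : Prop :=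
  is_dcpo le /\
  forall x, directed le (fun y => way_below le y x) /\
            is_lub le (fun y => way_below le y x) x.

Definition scott_open {D : Type} (le : D -> D -> Prop) (U : D -> Prop) : Prop :=
  (forall x y, U x -> le x y -> U y) /\
  (forall S s, directed le S -> is_lub le S s -> U s -> exists z, S z /\ U z).

Definition closed {X : Type} (opn : (X -> Prop) -> Prop) (C : X -> Prop) : Prop :=
  opn (fun x => ~ C x).

Definition irreducible_closed {X : Type} (opn : (X -> Prop) -> Prop) (C : X -> Prop) : Prop :=
  closed opn C /\ (exists x, C x) /\
  forall F1 F2, closed opn F1 -> closed opn F2 ->
    (forall x, C x -> F1 x \/ F2 x) ->
    (forall x, C x -> F1 x) \/ (forall x, C x -> F2 x).

Definition closure_pt {X : Type} (opn : (X -> Prop) -> Prop) (x : X) : X -> Prop :=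
  fun y => forall U, opn U -> U y -> U x.

Definition sober {X : Type} (opn : (X -> Prop) -> Prop) : Prop :=
  forall C, irreducible_closed opn C ->
    exists! x, forall y, C y <-> closure_pt opn x y.

Definition compact_set {X : Type} (opn : (X -> Prop) -> Prop) (Q : X -> Prop) : Prop :=
  forall F : (X -> Prop) -> Prop, (forall U, F U -> opn U) ->
    (forall x, Q x -> exists U, F U /\ U x) ->
    exists l : list (X -> Prop), (forall U, In U l -> F U) /\
      forall x, Q x -> exists U, In U l /\ U x.

Definition saturated {X : Type} (opn : (X -> Prop) -> Prop) (Q : X -> Prop) : Prop :=
  forall x, (forall U, opn U -> (forall y, Q y -> U y) -> U x) -> Q x.

Definition locally_compact {X : Type} (opn : (X -> Prop) -> Prop) : Prop :=
  forall x U, opn U -> U x ->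
    exists Q V, compact_set opn Q /\ saturated opn Q /\ opn V /\ V x /\
      (forall y, V y -> Q y) /\ (forall y, Q y -> U y).

Definition domain_complete {X : Type} (opn : (X -> Prop) -> Prop) : Prop :=
  exists (D : Type) (le : D -> D -> Prop) (A : D -> Prop),
    is_continuous_dcpo le /\ G_delta (scott_open le) A /\
    homeomorphic opn (subspace (scott_open le) A).

Definition LCS_complete {X : Type} (opn : (X -> Prop) -> Prop) : Prop :=
  exists (Y : Type) (oY : (Y -> Prop) -> Prop) (A : Y -> Prop),
    is_topology oY /\ sober oY /\ locally_compact oY /\ G_delta oY A /\
    homeomorphic opn (subspace oY A).

Definition is_metric {X : Type} (d : X -> X -> R) : Prop :=
  (forall x y, d x y = 0 <-> x = y) /\ (forall x y, d x y = d y x) /\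
  (forall x y z, d x z <= d x y + d y z).

Definition metric_open {X : Type} (d : X -> X -> R) (U : X -> Prop) : Prop :=
  forall x, U x -> exists eps, 0 < eps /\ forall y, d x y < eps -> U y.

Definition metric_complete {X : Type} (d : X -> X -> R) : Prop :=
  forall u : nat -> X,
    (forall eps, 0 < eps -> exists N, forall m n, (N <= m)%nat -> (N <= n)%nat ->
       d (u m) (u n) < eps) ->
    exists l, forall eps, 0 < eps -> exists N, forall n, (N <= n)%nat -> d (u n) l < eps.

Definition metrizable {X : Type} (opn : (X -> Prop) -> Prop) : Prop :=
  exists d : X -> X -> R, is_metric d /\ forall U, opn U <-> metric_open d U.

Definition completely_metrizable {X : Type} (opn : (X -> Prop) -> Prop) : Prop :=
  exists d : X -> X -> R, is_metric d /\ metric_complete d /\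
    forall U, opn U <-> metric_open d U.

(* Main.v *)
(** A complete metric space is the set of radius-0 elements of its continuous dcpo
    of formal balls, and a continuous dcpo is locally compact and sober.

    Conversely, let the metric space [X] be the intersection of open sets [U n] in a
    locally compact sober space [Y].  A Cauchy sequence that is eventually in every
    member of a decreasing sequence of compact saturated sets [Q n], [Q n] contained
    in [U n], converges in [X] by sobriety.  The [Q n] are built greedily: [Q (n+1)]
    is the least suitable compact set inside [Q n] for a fixed well-ordering of the
    subsets of [Y].  Taking least elements makes the construction locally constant
    enough that the Cauchy sequences at which it gets stuck form, in the completion
    of [X], a countable union of closed sets missing [X].  Adding the reciprocals of
    the distances to these sets to the metric makes [X] complete. *)

Require Import Defs.
From Stdlib Require Import Reals List Lra Lia Wf_nat Classical ClassicalEpsilon.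
From Stdlib Require Import FunctionalExtensionality PropExtensionality ProofIrrelevance.
From mathcomp Require boolp classical_sets wochoice.

Set Bullet Behavior "Strict Subproofs".

(** * Coherent choice and maximal elements *)

(** [L S] is the least element of [S] for a fixed well-ordering of [T]. If each of two least
    elements lies in the other set, each is below the other, so they agree. *)
Lemma coherent_choice (T : Type) (t0 : T) :
  exists L : (T -> Prop) -> T,
    (forall S : T -> Prop, (exists t, S t) -> S (L S)) /\
    (forall S S' : T -> Prop, S (L S') -> S' (L S) -> L S = L S').
Proof.
  (* The well-ordering principle is stated for an [eqType], so [T] is first traded for the carrier
     of one. *)
  revert t0; pattern T; apply boolp.Peq; clear T; intros T0 t0.
  destruct (wochoice.well_ordering_principle T0) as [R HR].
  set (T := eqtype.Equality.sort T0) in *.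
  set (mem := fun S : T -> Prop => fun t => boolp.asbool (S t)).
  assert (Hmin : forall S : T -> Prop, exists t, (exists t', S t') ->
            S t /\ forall s, S s -> is_true (R t s)).
  { intros S. destruct (classic (exists t, S t)) as [[t Ht] | Hn].
    - destruct (HR (mem S)) as [z [[Hz Hlb] _]].
      { exists t. apply boolp.asboolT, Ht. }
      exists z. intros _. split.
      + exact (boolp.asboolW Hz).
      + intros s Hs. apply Hlb. apply boolp.asboolT, Hs.
    - exists t0. intros H; contradiction. }
  apply choice in Hmin. destruct Hmin as [L HL].
  exists L. split.
  - intros S HS. apply HL, HS.
  - intros S S' H1 H2.
    destruct (HL S) as [HSL Hlb]; [now exists (L S')|].
    destruct (HL S') as [HSL' Hlb']; [now exists (L S)|].
    set (z := L S) in *; set (w := L S') in *.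
    (* Antisymmetry comes from uniqueness of minima: [z] and [w] are both least in the pair they
       form. *)
    destruct (HR (mem (fun t => t = z \/ t = w))) as [m [_ Hu]].
    { exists z. apply boolp.asboolT. now left. }
    transitivity m; [symmetry |]; apply Hu; split;
      try (apply boolp.asboolT; tauto);
      intros s Hs; destruct (boolp.asboolW Hs); subst s; auto.
Qed.

(** Zorn's lemma for the open sets that cover no [K n]: if the union of a chain covered the compact
    set [K n], finitely many members would, hence the largest of them alone. *)
Lemma maximal_open_missing (Y : Type) (oY : (Y -> Prop) -> Prop)
  (K : nat -> Y -> Prop) :
  is_topology oY -> (forall n, compact_set oY (K n)) ->
  (forall n, exists y, K n y) ->
  exists W, oY W /\ (forall n, exists y, K n y /\ ~ W y) /\
    forall W', oY W' -> (forall y, W y -> W' y) ->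
      (forall n, exists y, K n y /\ ~ W' y) -> forall y, W' y -> W y.
Proof.
  intros [_ [_ Hun]] HK Hne.
  destruct (@classical_sets.Zorn_bigcup Y
    (fun W => oY W /\ forall n, exists y, K n y /\ ~ W y)) as [W [[HW HWK] Hmax]].
  - intros F HF Htot.
    assert (E : classical_sets.bigcup F (fun X => X)
                = fun y => exists U, F U /\ U y).
    { apply functional_extensionality; intros y.
      apply propositional_extensionality; split.
      - intros [U HU Uy]. now exists U.
      - intros [U [HU Uy]]. now exists U. }
    rewrite E. split.
    + apply Hun. intros U HU. apply (HF U HU).
    + intros n. apply NNPP. intros Hn.
      destruct (HK n F) as [l [Hl Hcov]].
      * intros U HU. apply (HF U HU).
      * intros y Hy. apply NNPP. intros H. apply Hn. now exists y.
      * assert (Hsup : forall l : list (Y -> Prop), l <> nil ->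
            (forall U, In U l -> F U) ->
            exists M, F M /\ forall U, In U l -> forall y, U y -> M y).
        { clear l Hl Hcov. induction l as [|U l IH]; intros Hnil Hl; [easy|].
          destruct l as [|U' l].
          - exists U. split; [apply Hl; now left|].
            intros V [<- | []]; auto.
          - destruct IH as [M [HM HMl]]; [easy| intros V HV; apply Hl; now right|].
            destruct (Htot U M (Hl U (or_introl eq_refl)) HM) as [HUM | HMU].
            + exists M. split; [exact HM|]. intros V [<- | HV]; [exact HUM | exact (HMl V HV)].
            + exists U. split; [apply Hl; now left|].
              intros V [<- | HV] y Vy; auto. apply HMU. now apply (HMl V). }
        destruct (Hne n) as [y0 Hy0].
        destruct (Hsup l) as [M [HM HMl]].
        (* The point [y0] of [K n] rules out the empty list, and with it the empty chain. *)
        -- intros ->. destruct (Hcov y0 Hy0) as [U [[] _]].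
        -- exact Hl.
        -- destruct (HF M HM) as [_ HMK]. destruct (HMK n) as [y [Hy HMy]].
           apply HMy. destruct (Hcov y Hy) as [U [HU Uy]]. now apply (HMl U).
  - exists W. split; [exact HW|]. split; [exact HWK|].
    intros W' HW' Hsub HWK' y Hy. apply NNPP. intros HWy.
    apply (Hmax W'); [|now split].
    split; [exact Hsub|]. intros Hsub'. exact (HWy (Hsub' y Hy)).
Qed.

(** * The Scott topology of a continuous dcpo *)

Lemma scott_is_topology (D : Type) (le : D -> D -> Prop) :
  is_topology (scott_open le).
Proof.
  split; [|split].
  - split; [easy|]. intros S s [[x Hx] _] _ _. now exists x.
  - intros U V [HU1 HU2] [HV1 HV2]. split.
    + intros x y [Ux Vx] Hxy. split; [now apply (HU1 x) | now apply (HV1 x)].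
    + intros S s HS Hs [Us Vs].
      destruct (HU2 S s HS Hs Us) as [a [Sa Ua]].
      destruct (HV2 S s HS Hs Vs) as [b [Sb Vb]].
      destruct HS as [_ HS]. destruct (HS a b Sa Sb) as [c [Sc [Hac Hbc]]].
      exists c. split; [exact Sc|]. split; [now apply (HU1 a) | now apply (HV1 b)].
  - intros F HF. split.
    + intros x y [U [HU Ux]] Hxy. exists U. split; [exact HU|].
      now apply (proj1 (HF U HU) x).
    + intros S s HS Hs [U [HU Us]].
      destruct (proj2 (HF U HU) S s HS Hs Us) as [z [Sz Uz]].
      exists z. split; [exact Sz|]. now exists U.
Qed.

Section ContinuousDcpo.

Context {D : Type} {le : D -> D -> Prop} (Hcont : is_continuous_dcpo le).

Let poset : is_poset le := proj1 (proj1 Hcont).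
Let refl : forall x, le x x := proj1 poset.
Let antisym : forall x y, le x y -> le y x -> x = y := proj1 (proj2 poset).
Let trans : forall x y z, le x y -> le y z -> le x z := proj2 (proj2 poset).

Lemma way_below_le (x y : D) : way_below le x y -> le x y.
Proof.
  intros H. destruct (H (fun z => z = y) y) as [z [-> Hz]]; auto.
  - split; [now exists y|]. intros a b -> ->. exists y. auto.
  - split; [intros z ->; auto | intros u Hu; auto].
Qed.

Lemma way_below_mono (x' x y y' : D) :
  le x' x -> way_below le x y -> le y y' -> way_below le x' y'.
Proof.
  intros Hx H Hy S s HS Hs Hle.
  destruct (H S s HS Hs (trans _ _ _ Hy Hle)) as [z [Sz Hz]].
  exists z. split; [exact Sz|]. now apply (trans _ x).
Qed.

(** The elements way below something way below [y] form a directed set with supremum [y]; testing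
    [x] against this set produces the intermediate point. *)
Lemma way_below_interpolation (x y : D) :
  way_below le x y -> exists z, way_below le x z /\ way_below le z y.
Proof.
  intros Hxy.
  set (S := fun a => exists b, way_below le a b /\ way_below le b y).
  destruct (proj2 Hcont y) as [[[b0 Hb0] Hdir] Hlub].
  destruct (Hxy S y) as [z [[b [Hzb Hby]] Hxz]].
  - split.
    + destruct (proj2 Hcont b0) as [[[a0 Ha0] _] _]. now exists a0, b0.
    + intros a1 a2 [b1 [H1 Hb1]] [b2 [H2 Hb2]].
      destruct (Hdir b1 b2 Hb1 Hb2) as [b [Hb [Hb1b Hb2b]]].
      destruct (proj2 Hcont b) as [[_ Hdirb] _].
      destruct (Hdirb a1 a2) as [a [Ha [Ha1 Ha2]]].
      * apply (way_below_mono a1 a1 b1 b); auto.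
      * apply (way_below_mono a2 a2 b2 b); auto.
      * exists a. split; [now exists b | auto].
  - split.
    + intros a [b [Hab Hby]]. apply (trans _ b); now apply way_below_le.
    + intros u Hu. apply (proj2 Hlub). intros b Hb.
      apply (proj2 (proj2 (proj2 Hcont b))). intros a Ha. apply Hu. now exists b.
  - apply refl.
  - exists b. split; [|exact Hby]. now apply (way_below_mono x z b b).
Qed.

Lemma scott_open_way_above (x : D) : scott_open le (way_below le x).
Proof.
  split.
  - intros y z Hxy Hyz. now apply (way_below_mono x x y z).
  - intros S s HS Hs Hxs.
    destruct (way_below_interpolation x s Hxs) as [z [Hxz Hzs]].
    destruct (Hzs S s HS Hs (refl s)) as [w [Sw Hzw]].
    exists w. split; [exact Sw|]. now apply (way_below_mono x x z w).
Qed.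

Lemma scott_open_way_below_witness (U : D -> Prop) (x : D) :
  scott_open le U -> U x -> exists y, U y /\ way_below le y x.
Proof.
  intros [_ HU] Ux. destruct (proj2 Hcont x) as [Hdir Hlub].
  destruct (HU _ x Hdir Hlub Ux) as [y [Hy Uy]]. now exists y.
Qed.

(** The upper set of a point [y] of [U] way below [x] serves as [Q]: it is compact because an open
    set containing [y] already contains all of it. *)
Lemma scott_locally_compact : locally_compact (scott_open le).
Proof.
  intros x U HU Ux.
  destruct (scott_open_way_below_witness U x HU Ux) as [y [Uy Hyx]].
  exists (le y), (way_below le y). split; [|split; [|split; [|split; [|split]]]].
  - intros F HF Hcov. destruct (Hcov y (refl y)) as [V [HV Vy]].
    exists (V :: nil). split; [intros W [<- | []]; exact HV|].
    intros z Hz. exists V. split; [now left|]. now apply (proj1 (HF V HV) y).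
  - intros z Hz. apply (proj2 (proj2 (proj2 Hcont y))). intros a Ha.
    apply way_below_le, (Hz (way_below le a) (scott_open_way_above a)).
    intros w Hw. now apply (way_below_mono a a y w).
  - apply scott_open_way_above.
  - exact Hyx.
  - apply way_below_le.
  - intros z Hz. now apply (proj1 HU y).
Qed.

Lemma scott_closure_pt (x y : D) : closure_pt (scott_open le) x y <-> le y x.
Proof.
  split.
  - intros H. apply (proj2 (proj2 (proj2 Hcont y))). intros a Ha.
    apply way_below_le, (H _ (scott_open_way_above a) Ha).
  - intros Hyx U HU Uy. now apply (proj1 HU y).
Qed.

(** The generic point of [C] is the supremum of the elements way below members of [C];
    irreducibility makes this set directed. *)
Lemma scott_sober : sober (scott_open le).
Proof.
  intros C [Hcl [[x0 Cx0] Hirr]].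
  (* Irreducibility in terms of open sets: two that meet [C] have a common point in [C]. *)
  assert (Hmeet : forall U V, scott_open le U -> scott_open le V ->
            (exists x, C x /\ U x) -> (exists x, C x /\ V x) ->
            exists x, C x /\ U x /\ V x).
  { intros U V HU HV [a [Ca Ua]] [b [Cb Vb]]. apply NNPP. intros Hn.
    assert (Hcompl : forall W, scott_open le W ->
              closed (scott_open le) (fun x => ~ W x)).
    { intros W HW. unfold closed. replace (fun x => ~ ~ W x) with W; [exact HW|].
      apply functional_extensionality; intros x.
      apply propositional_extensionality; split; [tauto | apply NNPP]. }
    destruct (Hirr (fun x => ~ U x) (fun x => ~ V x)) as [H | H].
    - now apply Hcompl.
    - now apply Hcompl.
    - intros x Cx. destruct (classic (U x)) as [Ux|]; [|now left].
      right. intros Vx. apply Hn. now exists x.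
    - exact (H a Ca Ua).
    - exact (H b Cb Vb). }
  set (S := fun a => exists x, C x /\ way_below le a x).
  assert (HS : directed le S).
  { split.
    - destruct (proj2 Hcont x0) as [[[a Ha] _] _]. now exists a, x0.
    - intros a b Ha Hb.
      destruct (Hmeet (way_below le a) (way_below le b)) as [x [Cx [Hax Hbx]]];
        auto using scott_open_way_above.
      destruct (proj2 Hcont x) as [[_ Hdir] _].
      destruct (Hdir a b Hax Hbx) as [c [Hc [Hac Hbc]]].
      exists c. split; [now exists x | auto]. }
  destruct (proj2 (proj1 Hcont) S HS) as [s Hs].
  assert (Hdown : forall x y, C x -> le y x -> C y).
  { intros x y Cx Hyx. apply NNPP. intros HCy. apply (proj1 Hcl y x HCy Hyx Cx). }
  (* The complement of [C] is Scott open, so a supremum outside [C] would force a member of [S]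
     outside the lower set [C]. *)
  assert (Cs : C s).
  { apply NNPP. intros HCs. destruct (proj2 Hcl S s HS Hs HCs) as [a [[x [Cx Hax]] HCa]].
    apply HCa. apply (Hdown x); [exact Cx | now apply way_below_le]. }
  exists s. split.
  - intros y. rewrite scott_closure_pt. split; [|now apply Hdown].
    intros Cy. apply (proj2 (proj2 (proj2 Hcont y))). intros a Ha.
    apply (proj1 Hs). now exists y.
  - intros t Ht. apply antisym.
    + apply scott_closure_pt, Ht, Cs.
    + assert (Ct : C t) by (apply Ht, scott_closure_pt, refl).
      apply (proj2 (proj2 (proj2 Hcont t))). intros a Ha.
      apply (proj1 Hs). now exists t.
Qed.

End ContinuousDcpo.

Lemma domain_complete_LCS_complete (X : Type) (opn : (X -> Prop) -> Prop) :
  domain_complete opn -> LCS_complete opn.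
Proof.
  intros [D [le [A [Hcont [HA Hhom]]]]].
  exists D, (scott_open le), A.
  auto using scott_is_topology, scott_sober, scott_locally_compact.
Qed.

(** * Formal balls *)

Section FormalBalls.

Context {X : Type} {d : X -> X -> R} (Hd : is_metric d) (Hcomplete : metric_complete d).

Let d_refl : forall x, d x x = 0 := fun x => proj2 (proj1 Hd x x) eq_refl.
Let d_sym : forall x y, d x y = d y x := proj1 (proj2 Hd).
Let d_tri : forall x y z, d x z <= d x y + d y z := proj2 (proj2 Hd).

Lemma metric_nonneg (x y : X) : 0 <= d x y.
Proof. pose proof (d_tri x y x). rewrite d_refl, (d_sym y x) in H. lra. Qed.

Definition formal_ball : Type := {p : X * R | 0 <= snd p}.

Definition center (b : formal_ball) : X := fst (proj1_sig b).

Definition radius (b : formal_ball) : R := snd (proj1_sig b).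

Definition ball_of (x : X) (r : R) (Hr : 0 <= r) : formal_ball := exist _ (x, r) Hr.

(** Formal reverse inclusion: by the triangle inequality, the closed ball described by [c] is
    contained in the one described by [b]. Balls of radius 0 are maximal. *)
Definition ball_le (b c : formal_ball) : Prop :=
  d (center b) (center c) <= radius b - radius c.

Lemma radius_nonneg (b : formal_ball) : 0 <= radius b.
Proof. exact (proj2_sig b). Qed.

Lemma formal_ball_ext (b c : formal_ball) :
  center b = center c -> radius b = radius c -> b = c.
Proof.
  destruct b as [[x r] Hr], c as [[y s] Hs]. unfold center, radius; simpl.
  intros -> ->. f_equal. apply proof_irrelevance.
Qed.

Lemma ball_le_poset : is_poset ball_le.
Proof.
  unfold ball_le. split; [|split].
  - intros b. rewrite d_refl. lra.
  - intros b c H1 H2. rewrite d_sym in H2.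
    pose proof (metric_nonneg (center b) (center c)).
    apply formal_ball_ext; [apply (proj1 Hd); lra | lra].
  - intros a b c H1 H2. pose proof (d_tri (center a) (center b) (center c)). lra.
Qed.

(* The centers of members of [S] whose radii approach the infimum form a Cauchy
   sequence, because any two members of [S] lie below a third one. *)
Lemma ball_directed_lub (S : formal_ball -> Prop) :
  directed ball_le S ->
  exists s, Defs.is_lub ball_le S s /\
    forall e, 0 < e -> exists b, S b /\ radius b < radius s + e.
Proof.
  intros [[b0 Sb0] Hdir].
  assert (Hinf : exists r, 0 <= r /\ (forall b, S b -> r <= radius b) /\
            forall e, 0 < e -> exists b, S b /\ radius b < r + e).
  (* The infimum of the radii is minus the supremum of their opposites. *)
  { destruct (completeness (fun t => exists b, S b /\ t = - radius b)) as [m [Hub Hm]].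
    - exists 0. intros t [b [_ ->]]. pose proof (radius_nonneg b). lra.
    - exists (- radius b0). now exists b0.
    - exists (- m). split; [|split].
      + enough (m <= 0) by lra. apply Hm. intros t [b [_ ->]].
        pose proof (radius_nonneg b). lra.
      + intros b Sb. assert (- radius b <= m) by (apply Hub; now exists b). lra.
      + intros e He. apply NNPP. intros Hn.
        enough (m <= m - e) by lra. apply Hm. intros t [b [Sb ->]].
        destruct (Rle_or_lt (- m + e) (radius b)) as [|Hlt]; [lra|].
        exfalso. apply Hn. now exists b. }
  destruct Hinf as [r [Hr [Hlow Happ]]].
  assert (Hseq : forall n : nat, exists b, S b /\ radius b < r + / INR (n + 1)).
  { intros n. apply Happ, Rinv_0_lt_compat, lt_0_INR. lia. }
  apply choice in Hseq. destruct Hseq as [u Hu].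
  assert (Hpair : forall b c, S b -> S c ->
            d (center b) (center c) <= (radius b - r) + (radius c - r)).
  { intros b c Sb Sc. destruct (Hdir b c Sb Sc) as [z [Sz [Hb Hc]]].
    unfold ball_le in Hb, Hc. rewrite d_sym in Hc. specialize (Hlow z Sz).
    pose proof (d_tri (center b) (center z) (center c)). lra. }
  assert (Hsmall : forall e, 0 < e -> exists N, forall n, (N <= n)%nat ->
            radius (u n) < r + e).
  { intros e He. destruct (archimed_cor1 e He) as [N [HN HN0]].
    exists N. intros n Hn. destruct (Hu n) as [_ H].
    assert (/ INR (n + 1) <= / INR N).
    { apply Rinv_le_contravar; [now apply lt_0_INR | apply le_INR; lia]. }
    lra. }
  destruct (Hcomplete (fun n => center (u n))) as [x Hx].
  { intros e He. destruct (Hsmall (e / 2)) as [N HN]; [lra|].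
    exists N. intros m n Hm Hn.
    pose proof (Hpair (u m) (u n) (proj1 (Hu m)) (proj1 (Hu n))).
    pose proof (HN m Hm). pose proof (HN n Hn). lra. }
  assert (Hnear : forall e, 0 < e -> exists b, S b /\ radius b < r + e /\
            d (center b) x < e).
  { intros e He. destruct (Hsmall e He) as [N HN], (Hx e He) as [M HM].
    exists (u (N + M)%nat). split; [apply Hu|]. split; [apply HN | apply HM]; lia. }
  exists (ball_of x r Hr). split; [split|].
  - intros b Sb. unfold ball_le, ball_of; simpl. apply le_epsilon.
    intros e He. destruct (Hnear (e / 2)) as [c [Sc [Hc1 Hc2]]]; [lra|].
    pose proof (Hpair b c Sb Sc). pose proof (d_tri (center b) (center c) x).
    unfold center, radius in *; simpl in *. lra.
  - intros b Hb. unfold ball_le, ball_of; simpl. apply le_epsilon.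
    intros e He. destruct (Hnear (e / 2)) as [c [Sc [Hc1 Hc2]]]; [lra|].
    specialize (Hb c Sc). unfold ball_le in Hb.
    pose proof (d_tri x (center c) (center b)). rewrite (d_sym x (center c)) in H.
    unfold center, radius in *; simpl in *. lra.
  - exact Happ.
Qed.

(** Uniqueness of suprema transfers the radius estimate to any supremum [s]; the centers are then
    close because [b] lies below [s]. *)
Lemma ball_lub_approx (S : formal_ball -> Prop) (s : formal_ball) (e : R) :
  directed ball_le S -> Defs.is_lub ball_le S s -> 0 < e ->
  exists b, S b /\ radius b < radius s + e /\ d (center b) (center s) < e.
Proof.
  intros HS Hs He. destruct (ball_directed_lub S HS) as [t [Ht Happ]].
  assert (s = t) as ->.
  { apply ball_le_poset; [apply Hs, Ht | apply Ht, Hs]. }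
  destruct (Happ e He) as [b [Sb Hb]].
  pose proof (proj1 Ht b Sb) as Hle. unfold ball_le in Hle.
  exists b. split; [exact Sb|]. lra.
Qed.

(** This family serves as the test set for way-belowness and for Scott openness at [b]. *)
Lemma concentric_balls_directed (b : formal_ball) :
  let S := fun c => center c = center b /\ radius b < radius c in
  directed ball_le S /\ Defs.is_lub ball_le S b.
Proof.
  assert (Hpos : forall e, 0 < e -> 0 <= radius b + e).
  { intros e He. pose proof (radius_nonneg b). lra. }
  split; split.
  - exists (ball_of (center b) (radius b + 1) (Hpos 1 Rlt_0_1)).
    unfold center, radius; simpl. split; [easy | lra].
  - intros c c' [Hc Hr] [Hc' Hr'].
    destruct (Rle_or_lt (radius c) (radius c')); [exists c | exists c'];
      unfold ball_le; rewrite Hc, Hc', d_refl; split; auto; lra.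
  - intros c [Hc Hr]. unfold ball_le. rewrite Hc, d_refl. lra.
  - intros u Hu. unfold ball_le. apply le_epsilon. intros e He.
    specialize (Hu (ball_of (center b) (radius b + e) (Hpos e He))).
    unfold ball_le, center, radius in *; simpl in *.
    enough (d (fst (proj1_sig b)) (fst (proj1_sig u))
            <= snd (proj1_sig b) + e - snd (proj1_sig u)) by lra.
    apply Hu. split; [easy | lra].
Qed.

(** Testing on the balls concentric with [c] makes the inequality strict; conversely, strictness
    leaves slack for approximating a supremum. *)
Lemma ball_way_below (b c : formal_ball) :
  way_below ball_le b c <-> d (center b) (center c) < radius b - radius c.
Proof.
  split.
  - intros H. destruct (concentric_balls_directed c) as [Hdir Hlub].
    destruct (H _ c Hdir Hlub (proj1 ball_le_poset c)) as [z [[Hz Hr] Hle]].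
    unfold ball_le in Hle. rewrite Hz in Hle. lra.
  - intros H S s HS Hs Hcs. unfold ball_le in Hcs.
    (* Half of the slack pays for the excess radius of [z], the other half for the distance from its
       center to that of [s]. *)
    destruct (ball_lub_approx S s
      ((radius b - radius c - d (center b) (center c)) / 2) HS Hs) as [z [Sz [Hz1 Hz2]]];
      [lra|].
    exists z. split; [exact Sz|]. unfold ball_le.
    pose proof (proj1 Hs z Sz) as Hzs. unfold ball_le in Hzs.
    pose proof (d_tri (center b) (center c) (center z)).
    pose proof (d_tri (center c) (center s) (center z)).
    rewrite (d_sym (center s) (center z)) in H1. lra.
Qed.

Lemma formal_ball_continuous_dcpo : is_continuous_dcpo ball_le.
Proof.
  split; [split|].
  - exact ball_le_poset.
  - intros S HS. destruct (ball_directed_lub S HS) as [s [Hs _]]. now exists s.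
  - intros b. destruct (concentric_balls_directed b) as [[[c0 Hc0] _] Hlub].
    assert (Hconc : forall c, center c = center b -> radius b < radius c ->
              way_below ball_le c b).
    { intros c Hc Hr. apply ball_way_below. rewrite Hc, d_refl. lra. }
    split; split.
    + exists c0. now apply Hconc.
    + intros x y Hx Hy. rewrite ball_way_below in Hx, Hy.
      (* The largest radius for which the ball around [center b] is still above both [x] and [y]. *)
      set (m := Rmin (radius x - d (center x) (center b))
                     (radius y - d (center y) (center b))).
      assert (Hm : radius b < m) by (apply Rmin_glb_lt; lra).
      assert (Hm0 : 0 <= m) by (pose proof (radius_nonneg b); lra).
      pose proof (Rmin_l (radius x - d (center x) (center b))
                         (radius y - d (center y) (center b))) as Hl.
      pose proof (Rmin_r (radius x - d (center x) (center b))
                         (radius y - d (center y) (center b))) as Hr.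
      fold m in Hl, Hr.
      exists (ball_of (center b) m Hm0). split; [now apply Hconc|].
      unfold ball_le, center, radius in *; simpl in *. lra.
    + intros c Hc. apply ball_way_below in Hc. unfold ball_le. lra.
    + intros u Hu. apply (proj2 Hlub). intros c [Hc Hr]. apply Hu. now apply Hconc.
Qed.

Lemma scott_open_radius_lt (r : R) : scott_open ball_le (fun b => radius b < r).
Proof.
  split.
  - intros b c Hb Hle. unfold ball_le in Hle.
    pose proof (metric_nonneg (center b) (center c)). lra.
  - intros S s HS Hs Hr.
    destruct (ball_lub_approx S s (r - radius s) HS Hs) as [b [Sb [Hb _]]]; [lra|].
    exists b. split; [exact Sb | lra].
Qed.

(** For open [U], this Scott open set cuts out exactly [U] on the balls of radius 0. The margin
    between [radius b] and [e] is what survives a passage to approximating balls. *)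
Lemma scott_open_balls_within (U : X -> Prop) :
  scott_open ball_le
    (fun b => exists e, radius b < e /\ forall y, d (center b) y < e -> U y).
Proof.
  split.
  - intros b c [e [He HU]] Hle. unfold ball_le in Hle.
    exists (e - d (center b) (center c)). split; [lra|].
    intros y Hy. apply HU. pose proof (d_tri (center b) (center c) y). lra.
  - intros S s HS Hs [e [He HU]].
    destruct (ball_lub_approx S s ((e - radius s) / 2) HS Hs) as [b [Sb [Hb1 Hb2]]];
      [lra|].
    (* The midpoint of [radius s] and [e] exceeds [radius b], and the remaining half of the gap
       covers the shift of center. *)
    exists b. split; [exact Sb|]. exists ((e + radius s) / 2). split; [lra|].
    intros y Hy. apply HU. pose proof (d_tri (center s) (center b) y).
    rewrite (d_sym (center s) (center b)) in H. lra.
Qed.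

(** A ball of radius 0 is the supremum of its concentric enlargements, so [W] contains one of
    positive radius [r]; every point at distance less than [r] is above it. *)
Lemma metric_open_scott_trace (W : formal_ball -> Prop) :
  scott_open ball_le W -> metric_open d (fun x => W (ball_of x 0 (Rle_refl 0))).
Proof.
  intros [Hup HW] x Wx.
  destruct (concentric_balls_directed (ball_of x 0 (Rle_refl 0))) as [Hdir Hlub].
  destruct (HW _ _ Hdir Hlub Wx) as [b [[Hc Hr] Wb]].
  unfold center, radius in Hc, Hr; simpl in Hc, Hr.
  exists (radius b). split; [exact Hr|]. intros y Hy. apply (Hup b); [exact Wb|].
  unfold ball_le, center, radius in *; simpl. rewrite Hc. lra.
Qed.

Lemma complete_metric_domain_complete : domain_complete (metric_open d).
Proof.
  exists formal_ball, ball_le, (fun b => radius b = 0).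
  split; [exact formal_ball_continuous_dcpo|]. split.
  - exists (fun n b => radius b < / INR (n + 1)). split.
    + intros n. apply scott_open_radius_lt.
    + intros b. split.
      * intros -> n. apply Rinv_0_lt_compat, lt_0_INR. lia.
      * intros H. apply Rle_antisym; [|apply radius_nonneg].
        apply Rnot_lt_le. intros Hpos.
        destruct (archimed_cor1 _ Hpos) as [N [HN HN0]].
        specialize (H (N - 1)%nat). replace (N - 1 + 1)%nat with N in H by lia. lra.
  - exists (fun x => exist (fun b => radius b = 0) (ball_of x 0 (Rle_refl 0)) eq_refl).
    exists (fun z => center (proj1_sig z)).
    split; [|split; [|split]].
    + easy.
    + intros [b Hb]. simpl. apply subset_eq_compat. apply formal_ball_ext; easy.
    + intros V [W [HW HVW]] x Vx. apply HVW in Vx.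
      destruct (metric_open_scott_trace W HW x Vx) as [e [He HWe]].
      exists e. split; [exact He|]. intros y Hy. apply HVW. now apply HWe.
    + intros U HU.
      exists (fun b => exists e, radius b < e /\ forall y, d (center b) y < e -> U y).
      split; [apply scott_open_balls_within|].
      intros [b Hb]; simpl. split.
      * intros Ub. destruct (HU _ Ub) as [e [He HUe]]. exists e. split; [lra | exact HUe].
      * intros [e [He HUe]]. apply HUe. rewrite d_refl. lra.
Qed.

End FormalBalls.

(** * Remetrization *)

Definition cauchy {X : Type} (d : X -> X -> R) (u : nat -> X) : Prop :=
  forall eps, 0 < eps -> exists N, forall m n, (N <= m)%nat -> (N <= n)%nat ->
    d (u m) (u n) < eps.

Definition converges {X : Type} (d : X -> X -> R) (u : nat -> X) (l : X) : Prop :=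
  forall eps, 0 < eps -> exists N, forall n, (N <= n)%nat -> d (u n) l < eps.

Lemma common_radius (P : nat -> R -> Prop) (N : nat) :
  (forall n r s, P n r -> s <= r -> P n s) ->
  (forall n, (n < N)%nat -> exists r, 0 < r /\ P n r) ->
  exists r, 0 < r /\ forall n, (n < N)%nat -> P n r.
Proof.
  intros Hmono. induction N as [|N IH]; intros H.
  - exists 1. split; [lra | lia].
  - destruct IH as [r [Hr HP]]; [intros n Hn; apply H; lia|].
    destruct (H N) as [s [Hs HPs]]; [lia|].
    exists (Rmin r s). split; [now apply Rmin_glb_lt|].
    intros n Hn. destruct (Nat.eq_dec n N) as [-> | Hne].
    + now apply (Hmono N s), Rmin_r.
    + apply (Hmono n r); [apply HP; lia | apply Rmin_l].
Qed.

Section Remetrization.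

Context {X : Type} {d : X -> X -> R} (Hd : is_metric d).

Let d_refl : forall x, d x x = 0 := fun x => proj2 (proj1 Hd x x) eq_refl.
Let d_sym : forall x y, d x y = d y x := proj1 (proj2 Hd).
Let d_tri : forall x y z, d x z <= d x y + d y z := proj2 (proj2 Hd).

(** The new metric is the supremum of [d] and of the differences of the [/ f n], truncated at
    [/ INR (n + 1)]. Being Cauchy for it bounds each [/ f n] along the sequence, while the vanishing
    truncations leave the topology unchanged. *)
Lemma remetrize_by_positive_functions (f : nat -> X -> R) :
  (forall n x, 0 < f n x) -> (forall n x y, f n x - d x y <= f n y) ->
  (forall u, cauchy d u ->
     (forall n, exists r, 0 < r /\ exists N, forall k, (N <= k)%nat -> r <= f n (u k)) ->
     exists l, converges d u l) ->
  completely_metrizable (metric_open d).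
Proof.
  intros Hpos Hlip Hconv.
  set (q := fun n x y => Rabs (/ f n x - / f n y)).
  set (p := fun n x y => Rmin (/ INR (n + 1)) (q n x y)).
  assert (Hw : forall n, 0 < / INR (n + 1)).
  { intros n. apply Rinv_0_lt_compat, lt_0_INR. lia. }
  assert (Hw1 : forall n, / INR (n + 1) <= 1).
  { intros n. rewrite <- Rinv_1. apply Rinv_le_contravar; [lra|].
    apply (le_INR 1). lia. }
  assert (Hlub : forall x y, exists s, Raxioms.is_lub
            (fun t => t = d x y \/ exists n, t = p n x y) s).
  { intros x y. destruct (completeness (fun t => t = d x y \/ exists n, t = p n x y))
      as [s Hs].
    - exists (Rmax 1 (d x y)). intros t [-> | [n ->]]; [apply Rmax_r|].
      apply Rle_trans with 1; [|apply Rmax_l].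
      apply Rle_trans with (/ INR (n + 1)); [apply Rmin_l | apply Hw1].
    - exists (d x y). now left.
    - now exists s. }
  assert (Hchoice : exists d' : X -> X -> R, forall x y, Raxioms.is_lub
            (fun t => t = d x y \/ exists n, t = p n x y) (d' x y)).
  { destruct (choice (fun (xy : X * X) s => Raxioms.is_lub
       (fun t => t = d (fst xy) (snd xy) \/ exists n, t = p n (fst xy) (snd xy)) s))
      as [h Hh]; [intros [x y]; apply Hlub|].
    exists (fun x y => h (x, y)). intros x y. exact (Hh (x, y)). }
  destruct Hchoice as [d' Hd'].
  assert (Hdd' : forall x y, d x y <= d' x y).
  { intros x y. apply Hd'. now left. }
  assert (Hpd' : forall n x y, p n x y <= d' x y).
  { intros n x y. apply Hd'. right. now exists n. }
  assert (Hub : forall x y b, d x y <= b -> (forall n, p n x y <= b) -> d' x y <= b).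
  { intros x y b H1 H2. apply Hd'. intros t [-> | [n ->]]; auto. }
  assert (Hp0 : forall n x, p n x x = 0).
  { intros n x. unfold p, q. rewrite Rminus_diag, Rabs_R0.
    apply Rmin_right. left. apply Hw. }
  assert (Hpsym : forall n x y, p n x y = p n y x).
  { intros n x y. unfold p, q. now rewrite Rabs_minus_sym. }
  assert (Hptri : forall n x y z, p n x z <= p n x y + p n y z).
  { intros n x y z. unfold p, q. specialize (Hw n).
    pose proof (Rabs_triang (/ f n x - / f n y) (/ f n y - / f n z)) as Ht.
    replace (/ f n x - / f n y + (/ f n y - / f n z)) with (/ f n x - / f n z) in Ht
      by lra.
    pose proof (Rabs_pos (/ f n x - / f n y)). pose proof (Rabs_pos (/ f n y - / f n z)).
    unfold Rmin. repeat destruct Rle_dec; lra. }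
  assert (Hlocal : forall x e, 0 < e ->
            exists r, 0 < r /\ forall y, d x y < r -> d' x y < e).
  { intros x e He. destruct (archimed_cor1 (e / 2)) as [N [HN HN0]]; [lra|].
    destruct (common_radius (fun n r => forall y, d x y < r -> q n x y <= e / 2) N)
      as [r [Hr Hq]].
    - intros n r s H Hsr y Hy. apply H. lra.
    - intros n _. specialize (Hpos n).
      pose proof (Hpos x) as Hx.
      set (a := f n x) in *.
      (* The bound [a / 2] keeps [f n y] at least [a / 2]; with the second bound, the reciprocals
         then differ by at most [(e * a * a / 4) / (a * (a / 2))], which is [e / 2]. *)
      exists (Rmin (a / 2) (e * a * a / 4)). split.
      { apply Rmin_glb_lt; [lra|]. apply Rdiv_lt_0_compat; [|lra].
        repeat apply Rmult_lt_0_compat; lra. }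
      intros y Hy. pose proof (Hlip n x y) as H1. pose proof (Hlip n y x) as H2.
      rewrite d_sym in H2. fold a in H1, H2.
      pose proof (Rmin_l (a / 2) (e * a * a / 4)).
      pose proof (Rmin_r (a / 2) (e * a * a / 4)).
      pose proof (Hpos y) as Hy0. set (b := f n y) in *.
      unfold q. fold a b. replace (/ a - / b) with ((b - a) / (a * b)) by (field; lra).
      assert (Hab : 0 < a * b) by now apply Rmult_lt_0_compat.
      unfold Rdiv. rewrite Rabs_mult, (Rabs_right (/ (a * b)))
        by (apply Rle_ge, Rlt_le, Rinv_0_lt_compat, Hab).
      apply Rmult_le_reg_r with (a * b); [exact Hab|].
      rewrite Rmult_assoc, Rinv_l, Rmult_1_r by lra.
      apply Rle_trans with (e * a * a / 4).
      + apply Rabs_le. lra.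
      + assert (a / 2 <= b) by lra.
        assert (e * a * (a / 2) <= e * a * b).
        { apply Rmult_le_compat_l; [|lra]. apply Rlt_le, Rmult_lt_0_compat; lra. }
        lra.
    - exists (Rmin r (e / 2)). split; [apply Rmin_glb_lt; lra|].
      intros y Hy. apply Rle_lt_trans with (e / 2); [|lra]. apply Hub.
      + pose proof (Rmin_r r (e / 2)). lra.
      (* Below [N] continuity of the [n]-th term is used; from [N] on its truncation is small
         enough. *)
      + intros n. destruct (Nat.lt_ge_cases n N) as [Hn | Hn].
        * apply Rle_trans with (q n x y); [apply Rmin_r|]. apply Hq; [exact Hn|].
          pose proof (Rmin_l r (e / 2)). lra.
        * apply Rle_trans with (/ INR (n + 1)); [apply Rmin_l|].
          apply Rle_trans with (/ INR N); [|lra].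
          apply Rinv_le_contravar; [now apply lt_0_INR | apply le_INR; lia]. }
  assert (Hd'refl : forall x, d' x x = 0).
  { intros x. apply Rle_antisym.
    - apply Hub; [rewrite d_refl; lra | intros n; rewrite Hp0; lra].
    - rewrite <- (d_refl x) at 1. apply Hdd'. }
  assert (Hd'sym : forall x y, d' x y <= d' y x).
  { intros x y. apply Hub; [rewrite d_sym; apply Hdd' | intros n; rewrite Hpsym; apply Hpd']. }
  assert (Hd'metric : is_metric d').
  { split; [|split].
    - intros x y. split; [|intros ->; apply Hd'refl].
      intros H. apply (proj1 Hd). apply Rle_antisym; [rewrite <- H; apply Hdd'|].
      apply (metric_nonneg Hd).
    - intros x y. now apply Rle_antisym.
    - intros x y z. apply Hub.
      + pose proof (d_tri x y z). pose proof (Hdd' x y). pose proof (Hdd' y z). lra.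
      + intros n. pose proof (Hptri n x y z).
        pose proof (Hpd' n x y). pose proof (Hpd' n y z). lra. }
  exists d'. split; [exact Hd'metric|]. split.
  - intros u Hu. destruct (Hconv u) as [l Hl].
    + intros e He. destruct (Hu e He) as [N HN]. exists N. intros m n Hm Hn.
      apply Rle_lt_trans with (d' (u m) (u n)); auto.
    + intros n. destruct (Hu _ (Hw n)) as [N HN].
      assert (HuN := Rinv_0_lt_compat _ (Hpos n (u N))).
      (* From stage [N] on the distance is below the truncation level, itself at most 1, so
         [/ f n (u k)] stays within 1 of [/ f n (u N)]. *)
      exists (/ (/ f n (u N) + 1)). split; [apply Rinv_0_lt_compat; lra|].
      exists N. intros k Hk. specialize (HN k N Hk (le_n N)).
      assert (Hp : p n (u k) (u N) < / INR (n + 1)).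
      { apply Rle_lt_trans with (d' (u k) (u N)); auto. }
      assert (Hq : q n (u k) (u N) < 1).
      { specialize (Hw1 n). unfold p, Rmin in Hp. destruct Rle_dec; lra. }
      apply Rabs_def2 in Hq.
      rewrite <- (Rinv_inv (f n (u k))).
      apply Rinv_le_contravar; [apply Rinv_0_lt_compat, Hpos | lra].
    + exists l. intros e He. destruct (Hlocal l e He) as [r [Hr H]].
      destruct (Hl r Hr) as [N HN]. exists N. intros n Hn.
      apply Rle_lt_trans with (d' l (u n)); [apply Hd'sym|].
      apply H. rewrite d_sym. now apply HN.
  - intros U. split; intros HU x Ux; destruct (HU x Ux) as [e [He H]].
    + exists e. split; [exact He|]. intros y Hy. apply H.
      apply Rle_lt_trans with (d' x y); auto.
    + destruct (Hlocal x e He) as [r [Hr Hr']]. exists r. auto.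
Qed.

(* [Bad n] plays the role of a closed set of points of the completion missing [X],
   and [f n x] below is the distance (truncated at 1) from [x] to it. *)
Lemma remetrize_avoiding_bad_sequences (Bad : nat -> (nat -> X) -> Prop) :
  (forall n x, exists r, 0 < r /\ forall u, Bad n u ->
     ~ exists N, forall k, (N <= k)%nat -> d x (u k) < r) ->
  (forall u, cauchy d u -> (forall n, ~ Bad n u) -> exists l, converges d u l) ->
  completely_metrizable (metric_open d).
Proof.
  intros Havoid Hconv.
  (* The condition [r <= 1] keeps the set bounded above even when no sequence satisfies [Bad n]. *)
  set (S := fun n x r => r <= 1 /\ forall u, Bad n u ->
              ~ exists N, forall k, (N <= k)%nat -> d x (u k) < r).
  assert (Hsup : forall n x, exists m, Raxioms.is_lub (S n x) m).
  { intros n x. destruct (completeness (S n x)) as [m Hm].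
    - exists 1. intros r [Hr _]. exact Hr.
    - destruct (Havoid n x) as [r [Hr H]]. exists (Rmin r 1). split; [apply Rmin_r|].
      intros u Hu [N HN]. apply (H u Hu). exists N. intros k Hk.
      pose proof (HN k Hk). pose proof (Rmin_l r 1). lra.
    - now exists m. }
  destruct (choice (fun (nx : nat * X) m => Raxioms.is_lub (S (fst nx) (snd nx)) m))
    as [h Hh]; [intros [n x]; apply Hsup|].
  set (f := fun n x => h (n, x)).
  assert (Hf : forall n x, Raxioms.is_lub (S n x) (f n x)).
  { intros n x. exact (Hh (n, x)). }
  apply (remetrize_by_positive_functions f).
  - intros n x. destruct (Havoid n x) as [r [Hr H]].
    apply Rlt_le_trans with (Rmin r 1); [apply Rmin_glb_lt; lra|].
    apply Hf. split; [apply Rmin_r|].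
    intros u Hu [N HN]. apply (H u Hu). exists N. intros k Hk.
    pose proof (HN k Hk). pose proof (Rmin_l r 1). lra.
  - intros n x y. enough (f n x <= f n y + d x y) by lra.
    apply (Hf n x). intros r [Hr1 HS]. enough (r - d x y <= f n y) by lra.
    apply (Hf n y). split.
    + pose proof (metric_nonneg Hd x y). lra.
    + intros u Hu [N HN]. apply (HS u Hu). exists N. intros k Hk.
      pose proof (HN k Hk). pose proof (d_tri x y (u k)). lra.
  - intros u Hu Hlow. apply Hconv; [exact Hu|]. intros n Hbad.
    destruct (Hlow n) as [r [Hr [N HN]]].
    destruct (Hu (r / 2)) as [M HM]; [lra|].
    set (k := (N + M)%nat).
    (* A bad Cauchy sequence stays within [r / 2] of its own late term [u k], so no larger radius
       around [u k] avoids it. *)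
    assert (f n (u k) <= r / 2).
    { apply (Hf n (u k)). intros s [_ Hs]. apply Rnot_lt_le. intros Hlt.
      apply (Hs u Hbad). exists M. intros j Hj.
      assert (d (u k) (u j) < r / 2) by (apply HM; unfold k; lia). lra. }
    assert (r <= f n (u k)) by (apply HN; unfold k; lia). lra.
Qed.

End Remetrization.

(** * From LCS-complete to completely metrizable *)

Lemma open_ext {Y : Type} (oY : (Y -> Prop) -> Prop) (V W : Y -> Prop) :
  oY V -> (forall y, V y <-> W y) -> oY W.
Proof.
  intros HV H. replace W with V; [exact HV|].
  apply functional_extensionality; intros y.
  apply propositional_extensionality, H.
Qed.

Lemma open_union2 {Y : Type} (oY : (Y -> Prop) -> Prop) (V W : Y -> Prop) :
  is_topology oY -> oY V -> oY W -> oY (fun y => V y \/ W y).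
Proof.
  intros [_ [_ Hun]] HV HW.
  apply (open_ext oY (fun y => exists Z, (Z = V \/ Z = W) /\ Z y)).
  - apply Hun. intros Z [-> | ->]; assumption.
  - intros y. split.
    + intros [Z [[-> | ->] Zy]]; auto.
    + intros [Vy | Wy]; [exists V | exists W]; auto.
Qed.

(** Adjoin the complement of [C] to the cover, extract a finite subcover of [Q], and drop the
    complement from it again. *)
Lemma compact_inter_closed {Y : Type} (oY : (Y -> Prop) -> Prop) (Q C : Y -> Prop) :
  compact_set oY Q -> closed oY C -> compact_set oY (fun y => Q y /\ C y).
Proof.
  intros HQ HC F HF Hcov.
  destruct (HQ (fun V => F V \/ V = fun y => ~ C y)) as [l [Hl Hlcov]].
  - intros V [HV | ->]; [now apply HF | exact HC].
  - intros y Qy. destruct (classic (C y)) as [Cy | HCy].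
    + destruct (Hcov y (conj Qy Cy)) as [V [HV Vy]]. exists V. auto.
    + exists (fun y => ~ C y). auto.
  - assert (Hsub : exists l', (forall V, In V l' -> F V) /\
              forall V y, In V l -> V y -> C y -> exists V', In V' l' /\ V' y).
    { clear Hlcov. induction l as [|V l IH].
      - exists nil. split; [intros V [] | intros V y []].
      - destruct IH as [l' [HF' Hl']]; [intros W HW; apply Hl; now right|].
        destruct (Hl V (or_introl eq_refl)) as [FV | EV].
        + exists (V :: l'). split.
          * intros W [<- | HW]; auto.
          * intros W y [<- | HW] Wy Cy; [exists V; split; [now left | exact Wy]|].
            destruct (Hl' W y HW Wy Cy) as [W' [HW' Wy']].
            exists W'. split; [now right | exact Wy'].
        + exists l'. split; [exact HF'|].
          intros W y [<- | HW] Wy Cy; [rewrite EV in Wy; contradiction|].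
          now apply (Hl' W y). }
    destruct Hsub as [l' [HF' Hl']]. exists l'. split; [exact HF'|].
    intros y [Qy Cy]. destruct (Hlcov y Qy) as [V [HV Vy]]. now apply (Hl' V y).
Qed.

Section EmbeddedGDelta.

Context {X : Type} {d : X -> X -> R} (Hd : is_metric d).

Let d_refl : forall x, d x x = 0 := fun x => proj2 (proj1 Hd x x) eq_refl.
Let d_sym : forall x y, d x y = d y x := proj1 (proj2 Hd).
Let d_tri : forall x y z, d x z <= d x y + d y z := proj2 (proj2 Hd).

Context {Y : Type} {oY : (Y -> Prop) -> Prop} (HY : is_topology oY) (Hsob : sober oY)
  (Hlc : locally_compact oY).

Context {e : X -> Y}
  (Hcts : forall W, oY W -> metric_open d (fun x => W (e x)))
  (Hemb : forall O, metric_open d O -> exists W, oY W /\ forall x, O x <-> W (e x)).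

Context {U : nat -> Y -> Prop} (HU : forall n, oY (U n))
  (Himg : forall y, (forall n, U n y) <-> exists x, e x = y).

(* A maximal open set [W] not covering any [Q n ∩ cl (tail n)] has irreducible
   complement; its generic point lies in every [Q n] and in every closure. *)
Lemma cauchy_in_nested_compacts_converges (u : nat -> X) (Q : nat -> Y -> Prop) :
  cauchy d u ->
  (forall n, compact_set oY (Q n)) -> (forall n, saturated oY (Q n)) ->
  (forall n y, Q (S n) y -> Q n y) -> (forall n y, Q n y -> U n y) ->
  (forall n, exists N, forall k, (N <= k)%nat -> Q n (e (u k))) ->
  exists l, converges d u l.
Proof.
  intros Hu HQc HQs HQdec HQU Htail.
  (* [C n] is the closure in [Y] of the tail of the image sequence from index [n]. *)
  set (C := fun n y => forall W, oY W -> W y -> exists k, (n <= k)%nat /\ W (e (u k))).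
  assert (HQmon : forall m n y, (m <= n)%nat -> Q n y -> Q m y).
  { intros m n y Hmn. induction Hmn; auto. }
  assert (HCmon : forall m n y, (m <= n)%nat -> C n y -> C m y).
  { intros m n y Hmn HC W HW Wy. destruct (HC W HW Wy) as [k [Hk Wk]].
    exists k. split; [lia | exact Wk]. }
  assert (HCcl : forall n, closed oY (C n)).
  { intros n. apply (open_ext oY (fun y => exists W,
      (oY W /\ forall k, (n <= k)%nat -> ~ W (e (u k))) /\ W y)).
    - apply HY. now intros W [HW _].
    - intros y. split.
      + intros [W [[HW Hmiss] Wy]] HC. destruct (HC W HW Wy) as [k [Hk Wk]].
        exact (Hmiss k Hk Wk).
      + intros HnC. apply NNPP. intros Hn. apply HnC. intros W HW Wy.
        apply NNPP. intros Hk. apply Hn. exists W. split; [|exact Wy].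
        split; [exact HW|]. intros k Hnk Wk. apply Hk. now exists k. }
  set (K := fun n y => Q n y /\ C n y).
  destruct (maximal_open_missing Y oY K HY) as [W [HW [HWK Hmax]]].
  { intros n. now apply compact_inter_closed. }
  { intros n. destruct (Htail n) as [N HN].
    exists (e (u (n + N)%nat)). split; [apply HN; lia|].
    intros W _ HWk. exists (n + N)%nat. split; [lia | exact HWk]. }
  assert (HKmon : forall m n y, (m <= n)%nat -> K n y -> K m y).
  { intros m n y Hmn [Qy Cy]. split; [now apply (HQmon m n) | now apply (HCmon m n)]. }
  assert (Hirr : irreducible_closed oY (fun y => ~ W y)).
  { split; [|split].
    - apply (open_ext oY W _ HW). intros y. split; [tauto | apply NNPP].
    - destruct (HWK 0%nat) as [y [_ HWy]]. now exists y.
    - intros F1 F2 HF1 HF2 Hcov.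
      (* By maximality, enlarging [W] by the complement of [F] either adds nothing or covers some
         [K n]. *)
      assert (Hcase : forall F, closed oY F ->
                (forall y, ~ W y -> F y) \/
                exists n, forall y, K n y -> W y \/ ~ F y).
      { intros F HF. destruct (classic (exists n, forall y, K n y -> W y \/ ~ F y))
          as [H | H]; [now right | left].
        intros y HWy. apply NNPP. intros HFy. apply HWy.
        apply (Hmax (fun y => W y \/ ~ F y)); [now apply open_union2 | auto | | auto].
        intros n. apply NNPP. intros Hn. apply H. exists n. intros z Hz.
        apply NNPP. intros HWF. apply Hn. now exists z. }
      destruct (Hcase F1 HF1) as [H1 | [n1 H1]]; [now left|].
      destruct (Hcase F2 HF2) as [H2 | [n2 H2]]; [now right|].
      destruct (HWK (n1 + n2)%nat) as [y [Ky HWy]]. exfalso.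
      destruct (H1 y); [apply (HKmon n1 (n1 + n2)%nat); [lia | exact Ky] | tauto |].
      destruct (H2 y); [apply (HKmon n2 (n1 + n2)%nat); [lia | exact Ky] | tauto |].
      destruct (Hcov y HWy); tauto. }
  destruct (Hsob _ Hirr) as [y [Hy _]].
  assert (HWy : ~ W y) by (apply Hy; intros V _ Vy; exact Vy).
  (* An open set around [Q n] contains some [z] outside [W]; as [z] lies in the closure of [y], it
     contains [y], and saturation applies. *)
  assert (HQy : forall n, Q n y).
  { intros n. apply HQs. intros V HV HQV. destruct (HWK n) as [z [[Qz _] HWz]].
    apply (proj1 (Hy z) HWz); auto. }
  (* Otherwise [W] could be enlarged by the complement of [C m]: the points of [K (n + m)] outside
     [W] remain uncovered because they lie in [C m]. *)
  assert (HCy : forall m, C m y).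
  { intros m. apply NNPP. intros HnC. apply HWy.
    apply (Hmax (fun y => W y \/ ~ C m y)).
    - apply open_union2; [exact HY | exact HW | apply HCcl].
    - auto.
    - intros n. destruct (HWK (n + m)%nat) as [z [Kz HWz]]. exists z. split.
      + apply (HKmon n (n + m)%nat); [lia | exact Kz].
      + intros [|HC]; [tauto|]. apply HC, (HCmon m (n + m)%nat); [lia | apply Kz].
    - now right. }
  destruct (proj1 (Himg y) (fun n => HQU n y (HQy n))) as [x Hx].
  exists x. intros eps Heps. destruct (Hu (eps / 2)) as [N HN]; [lra|].
  destruct (Hemb (fun z => d x z < eps / 2)) as [V [HV HVe]].
  { intros z Hz. exists (eps / 2 - d x z). split; [lra|].
    intros w Hw. pose proof (d_tri x z w). lra. }
  (* Since [e x] is in the closure of every tail, some late term is near [x]; the Cauchy property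
     brings all later terms near it. *)
  destruct (HCy N V HV) as [k [Hk Vk]].
  { rewrite <- Hx. apply HVe. rewrite d_refl. lra. }
  apply HVe in Vk. exists N. intros n Hn. pose proof (HN n k Hn Hk).
  pose proof (d_tri (u n) (u k) x). rewrite (d_sym (u k) x) in H0. lra.
Qed.

(** * Greedy choice of compact sets along a sequence *)

Definition interior_of (Q : Y -> Prop) (y : Y) : Prop :=
  exists V, oY V /\ (forall z, V z -> Q z) /\ V y.

(** A neighbourhood condition at the limit of [u], phrased with balls around the tail because a
    Cauchy sequence need not have a limit in [X]. *)
Definition uniformly_inside (r : R) (u : nat -> X) (Q : Y -> Prop) : Prop :=
  exists N, forall k, (N <= k)%nat -> forall z, d (u k) z < r -> interior_of Q (e z).

Definition candidate (n : nat) (P : Y -> Prop) (u : nat -> X) (Q : Y -> Prop) : Prop :=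
  compact_set oY Q /\ saturated oY Q /\ (forall y, Q y -> P y) /\
  (forall y, Q y -> U n y) /\ exists r, 0 < r /\ uniformly_inside r u Q.

Context {L : ((Y -> Prop) -> Prop) -> Y -> Prop}
  (HL : forall S : (Y -> Prop) -> Prop, (exists Q, S Q) -> S (L S))
  (HLcoh : forall S S' : (Y -> Prop) -> Prop, S (L S') -> S' (L S) -> L S = L S').

(** Level 0 is the whole space, so [path (S n) u] is the set to be placed inside [U n]. If there is
    no candidate, the value of [L] carries no information. *)
Fixpoint path (n : nat) (u : nat -> X) : Y -> Prop :=
  match n with
  | O => fun _ => True
  | S n => L (candidate n (path n u) u)
  end.

Definition extends (n : nat) (u : nat -> X) : Prop :=
  exists Q, candidate n (path n u) u Q.

(* Bounding below the size [1 / (m + 1)] of the neighbourhoods involved is what makes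
   [stuck m] avoid a neighbourhood of each point of [X]. *)
Definition stuck (m : nat) (u : nat -> X) : Prop :=
  exists n, (n <= m)%nat /\ (forall i, (i < n)%nat -> extends i u) /\
    ~ extends n u /\
    forall i, (i <= n)%nat -> uniformly_inside (/ INR (m + 1)) u (path i u).

Lemma path_candidate (n : nat) (u : nat -> X) :
  extends n u -> candidate n (path n u) u (path (S n) u).
Proof. apply HL. Qed.

Lemma uniformly_inside_mono (r s : R) (u : nat -> X) (Q : Y -> Prop) :
  uniformly_inside r u Q -> s <= r -> uniformly_inside s u Q.
Proof.
  intros [N HN] Hsr. exists N. intros k Hk z Hz. apply (HN k Hk). lra.
Qed.

Lemma path_uniformly_inside (n : nat) (u : nat -> X) :
  (forall i, (i < n)%nat -> extends i u) ->
  exists r, 0 < r /\ uniformly_inside r u (path n u).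
Proof.
  destruct n as [|n]; intros H.
  - exists 1. split; [lra|]. exists 0%nat. intros k _ z _.
    exists (fun _ => True). split; [apply HY | easy].
  - destruct (path_candidate n u) as [_ [_ [_ [_ Hr]]]]; [apply H; lia | exact Hr].
Qed.

Lemma path_uniformly_inside_below (n : nat) (u : nat -> X) :
  (forall i, (i < n)%nat -> extends i u) ->
  exists r, 0 < r /\ forall i, (i < S n)%nat -> uniformly_inside r u (path i u).
Proof.
  intros H. apply (common_radius (fun i r => uniformly_inside r u (path i u))).
  - intros i r s. apply uniformly_inside_mono.
  - intros i Hi. apply path_uniformly_inside. intros j Hj. apply H. lia.
Qed.

(** Genuine points of [X] never get stuck: local compactness at [e x], inside both [U n] and the
    interior of the current set, supplies a candidate. *)
Lemma constant_path_extends (x : X) (n : nat) : extends n (fun _ => x).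
Proof.
  induction n as [n IH] using (well_founded_induction Wf_nat.lt_wf).
  destruct (path_uniformly_inside n (fun _ => x) IH) as [r [Hr [N HN]]].
  destruct (HN N (le_n N) x) as [V [HV [HVP Vx]]]; [rewrite d_refl; exact Hr|].
  assert (HUx : U n (e x)) by (apply Himg; now exists x).
  destruct (Hlc (e x) (fun y => V y /\ U n y)) as [Q [V' [Hc [Hs [HV' [V'x [HVQ HQ]]]]]]].
  { now apply HY. }
  { now split. }
  exists Q. split; [exact Hc|]. split; [exact Hs|]. split; [|split].
  - intros y Qy. apply HVP, (HQ y Qy).
  - intros y Qy. apply (HQ y Qy).
  - destruct (Hcts V' HV' x V'x) as [s [Hs0 HsV]]. exists s. split; [exact Hs0|].
    exists 0%nat. intros k _ z Hz. exists V'. auto.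
Qed.

(** If a stuck [u] stayed close to [x], its chosen sets would be candidates for the constant
    sequence at [x] and conversely. Coherence makes the two paths agree up to level [n], and the
    next set for [x] then extends [u]. *)
Lemma stuck_avoids (m : nat) (x : X) :
  exists r, 0 < r /\ forall u, stuck m u ->
    ~ exists N, forall k, (N <= k)%nat -> d x (u k) < r.
Proof.
  set (c := fun _ : nat => x).
  (* Levels up to [S m] are needed because the candidate offered to [u] at level [i <= m] is
     [path (S i) c]. *)
  destruct (path_uniformly_inside_below (S m) c) as [s [Hs Hin]];
    [intros i _; exact (constant_path_extends x i)|].
  set (w := / INR (m + 1)).
  assert (Hw : 0 < w) by (apply Rinv_0_lt_compat, lt_0_INR; lia).
  set (r := Rmin (s / 2) (w / 2)).
  assert (Hrs : r <= s / 2) by apply Rmin_l.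
  assert (Hrw : r <= w / 2) by apply Rmin_r.
  exists r. split; [apply Rmin_glb_lt; lra|].
  intros u [n [Hnm [Hext [Hstuck Hunif]]]] [N HN].
  (* Moving the centers between [x] and the tail of [u] costs at most half the radius, here and in
     the converse transfer. *)
  assert (Hcu : forall i, (i < S (S m))%nat -> uniformly_inside (s / 2) u (path i c)).
  { intros i Hi. destruct (Hin i Hi) as [M HM]. exists N. intros k Hk z Hz.
    apply (HM M (le_n M)). unfold c. pose proof (d_tri x (u k) z).
    pose proof (HN k Hk). lra. }
  assert (Huc : forall i, (i <= n)%nat -> uniformly_inside (w / 2) c (path i u)).
  { intros i Hi. destruct (Hunif i Hi) as [M HM]. exists 0%nat. intros k _ z Hz.
    apply (HM (N + M)%nat); [lia|]. unfold c in Hz. fold w.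
    assert (Hk : d x (u (N + M)%nat) < r) by (apply HN; lia).
    pose proof (d_tri (u (N + M)%nat) x z). rewrite (d_sym _ x) in H. lra. }
  assert (Hcand : forall i, (i <= m)%nat -> path i u = path i c ->
            candidate i (path i u) u (path (S i) c)).
  { intros i Hi E. rewrite E.
    destruct (path_candidate i c (constant_path_extends x i)) as [H1 [H2 [H3 [H4 _]]]].
    repeat (split; [assumption|]). exists (s / 2). split; [lra|]. apply Hcu. lia. }
  assert (Heq : forall i, (i <= n)%nat -> path i u = path i c).
  { induction i as [|i IH]; intros Hi; [reflexivity|].
    assert (E : path i u = path i c) by (apply IH; lia).
    apply HLcoh.
    - apply Hcand; [lia | exact E].
    - change (candidate i (path i c) c (path (S i) u)). rewrite <- E.
      destruct (path_candidate i u) as [H1 [H2 [H3 [H4 _]]]]; [apply Hext; lia|].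
      repeat (split; [assumption|]). exists (w / 2). split; [lra|]. now apply Huc. }
  apply Hstuck. exists (path (S n) c). apply Hcand; [exact Hnm | now apply Heq].
Qed.

Lemma never_stuck_extends (u : nat -> X) (n : nat) :
  (forall m, ~ stuck m u) -> extends n u.
Proof.
  intros H. induction n as [n IH] using (well_founded_induction Wf_nat.lt_wf).
  destruct (path_uniformly_inside_below n u IH) as [r [Hr Hin]].
  destruct (archimed_cor1 r Hr) as [M [HM HM0]].
  (* The index [n + M] is at least [n] and also makes [/ INR (n + M + 1)] at most [r]. *)
  apply NNPP. intros Hn. apply (H (n + M)%nat). exists n.
  split; [lia|]. split; [exact IH|]. split; [exact Hn|].
  intros i Hi. apply uniformly_inside_mono with r; [apply Hin; lia|].
  apply Rle_trans with (/ INR M); [|lra].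
  apply Rinv_le_contravar; [now apply lt_0_INR | apply le_INR; lia].
Qed.

Lemma embedded_G_delta_completely_metrizable : completely_metrizable (metric_open d).
Proof.
  apply (remetrize_avoiding_bad_sequences Hd stuck); [exact stuck_avoids|].
  intros u Hu Hns.
  assert (Hcand : forall n, candidate n (path n u) u (path (S n) u)).
  { intros n. apply path_candidate. now apply never_stuck_extends. }
  (* The shift skips level 0, which is the whole space and need not be compact. *)
  apply (cauchy_in_nested_compacts_converges u (fun n => path (S n) u) Hu).
  - intros n. apply (Hcand n).
  - intros n. apply (Hcand n).
  - intros n. apply (Hcand (S n)).
  - intros n. apply (Hcand n).
  - intros n. destruct (Hcand n) as [_ [_ [_ [_ [r [Hr [N HN]]]]]]].
    exists N. intros k Hk. destruct (HN k Hk (u k)) as [V [_ [HVQ Vk]]].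
    + rewrite d_refl. exact Hr.
    + now apply HVQ.
Qed.

End EmbeddedGDelta.

Lemma completely_metrizable_ext {X : Type} (o o' : (X -> Prop) -> Prop) :
  (forall U, o U <-> o' U) -> completely_metrizable o -> completely_metrizable o'.
Proof.
  intros H [d [Hd [Hc Ho]]]. exists d. split; [exact Hd|]. split; [exact Hc|].
  intros U. rewrite <- H. apply Ho.
Qed.

(** The homeomorphism followed by the inclusion of [A] is the embedding [e], and the coherent choice
    is made among the subsets of [Y]. *)
Lemma metrizable_LCS_complete_completely_metrizable (X : Type)
  (opn : (X -> Prop) -> Prop) :
  metrizable opn -> LCS_complete opn -> completely_metrizable opn.
Proof.
  intros [d [Hd Ho]] [Y [oY [A [HY [Hsob [Hlc [[U [HU HA]] Hhom]]]]]]].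
  destruct Hhom as [f [g [Hgf [Hfg [Hf Hg]]]]].
  destruct (coherent_choice (Y -> Prop) (fun _ => True)) as [L [HL HLcoh]].
  apply (completely_metrizable_ext (metric_open d)); [intros V; symmetry; apply Ho|].
  apply (@embedded_G_delta_completely_metrizable X d Hd Y oY HY Hsob Hlc
           (fun x => proj1_sig (f x))) with (U := U) (L := L); auto.
  - intros W HW. apply Ho, (Hf (fun z => W (proj1_sig z))). now exists W.
  - intros O HO. apply Ho, Hg in HO. destruct HO as [W [HW HOW]].
    exists W. split; [exact HW|]. intros x. rewrite <- HOW, Hgf. reflexivity.
  - intros y. rewrite <- HA. split.
    + intros Ay. exists (g (exist _ y Ay)). now rewrite Hfg.
    + intros [x <-]. apply (proj2_sig (f x)).
Qed.

Theorem theorem9p2 (X : Type) (opn : (X -> Prop) -> Prop)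
  (Htop : is_topology opn) (Hmet : metrizable opn) :
  (LCS_complete opn <-> domain_complete opn) /\
  (domain_complete opn <-> completely_metrizable opn).
Proof.
  assert (Hcd : completely_metrizable opn -> domain_complete opn).
  { intros [d [Hd [Hc Ho]]].
    assert (opn = metric_open d) as ->.
    { apply functional_extensionality; intros U.
      apply propositional_extensionality, Ho. }
    now apply complete_metric_domain_complete. }
  pose proof (domain_complete_LCS_complete X opn).
  pose proof (metrizable_LCS_complete_completely_metrizable X opn Hmet).
  (* The three implications close a cycle: completely metrizable, domain-complete, LCS-complete, and
     back. *)
  tauto.
Qed.
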